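(* Let $E_1$, $E_2$ and $F$ be locally convex spaces and $\beta\colon E_1\times E_2\to F$ be a continuous bilinear map. If $E_1$ and $E_2$ have the countable neighbourhood property, then $\beta$ admits product estimates.
   Context: A locally convex space is a Hausdorff locally convex real topological vector space; $\mathbb{N}=\{1,2,\ldots\}$. Continuity of a bilinear map means joint continuity. Countable neighbourhood property: for continuous seminorms $p,q$ on a locally convex space $E$, write $p\preceq q$ if there is $C>0$ with $p\leq Cq$ pointwise. $E$ has the countable neighbourhood property if for each countable set $P$ of continuous seminorms on $E$ there is a continuous seminorm $q$ on $E$ with $p\preceq q$ for all $p\in P$. Product estimates: a bilinear map $\beta\colon E_1\times E_2\to F$ between locally convex spaces admits (satisfies) product estimates if for each double sequence $(p_{i,j})_{i,j\in\mathbb{N}}$ of continuous seminorms on $F$ there exist a sequence $(p_i)_{i\in\mathbb{N}}$ of continuous seminorms on $E_1$ and a sequence $(q_j)_{j\in\mathbb{N}}$ of continuous seminorms on $E_2$ such that $p_{i,j}(\beta(x,y))\leq p_i(x)q_j(y)$ for all $i,j\in\mathbb{N}$, $x\in E_1$, $y\in E_2$. *)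

(* Defs.v *)
From mathcomp Require Import all_boot all_order all_algebra.
From mathcomp Require Import sesquilinear.
From mathcomp Require Import all_classical all_reals all_analysis.

Set Implicit Arguments.
Unset Strict Implicit.
Unset Printing Implicit Defensive.

Import Order.TTheory GRing.Theory Num.Theory.
Import numFieldNormedType.Exports.

Local Open Scope classical_set_scope.
Local Open Scope ring_scope.

Record seminorm (R : realType) (E : lmodType R) (p : E -> R) : Prop := Seminorm {
  seminorm_ge0 : forall x, 0 <= p x;
  seminormD : forall x y, p (x + y) <= p x + p y;
  seminormZ : forall (a : R) x, p (a *: x) = `|a| * p x
}.

Definition continuous_seminorm (R : realType) (E : tvsType R) (p : E -> R) :
    Prop :=
  seminorm p /\ continuous p.

Definition seminorm_dominated (R : realType) (E : tvsType R) (p q : E -> R) :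
    Prop :=
  exists2 C : R, 0 < C & forall x, p x <= C * q x.

Definition countable_neighbourhood_property (R : realType) (E : tvsType R) :
    Prop :=
  forall P : set (E -> R), countable P ->
    (forall p, P p -> continuous_seminorm p) ->
    exists2 q : E -> R, continuous_seminorm q &
      forall p, P p -> seminorm_dominated p q.

(* Sequences are indexed by [nat], that is, from 0. *)
Definition product_estimates (R : realType) (E1 E2 F : tvsType R)
    (beta : {bilinear E1 -> E2 -> F}) : Prop :=
  forall pij : nat -> nat -> F -> R,
    (forall i j, continuous_seminorm (pij i j)) ->
    exists (p : nat -> E1 -> R) (q : nat -> E2 -> R),
      [/\ forall i, continuous_seminorm (p i),
          forall j, continuous_seminorm (q j) &
          forall i j x y, pij i j (beta x y) <= p i x * q j y].

(* Main.v *)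
Require Import Defs.
From mathcomp Require Import all_boot all_order all_algebra.
From mathcomp Require Import sesquilinear.
From mathcomp Require Import all_classical all_reals all_analysis.

Import Order.TTheory GRing.Theory Num.Theory.
Import numFieldNormedType.Exports.

Local Open Scope classical_set_scope.
Local Open Scope ring_scope.

(** A continuous bilinear map satisfies single estimates: for a continuous
    seminorm [P] on [F] there are continuous seminorms [r] on [E1] and [s] on
    [E2] with [P (beta x y) <= r x * s y] (lemma [bilinear_estimate]).  Given a
    double sequence of seminorms, this produces double sequences [r i j] and
    [s i j], and the countable neighbourhood property replaces each of them by
    one seminorm, up to a constant depending on [(i, j)] (lemma
    [cnp_double_sequence]).  The estimates become
    [pij i j (beta x y) <= A i j * (p x * q y)], and it remains to separate the
    indices in the constants: [A i j <= a i * a j], where [a n >= 1] bounds all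
    [A k l] with [k, l <= n] (lemma [double_sequence_le_product]).  The seminorms
    [a i * p x] and [a j * q y] are as required.

    Minkowski functionals are avoided in the single estimates.  If
    [P (beta x y) <= 1] for [x] in [U] and [y] in [V], let [r x] be the supremum
    of [P (beta x y)] over [y] in [V], and [s y] its supremum over all [x] with
    [r x <= 1].  Both are suprema of families of seminorms that are bounded by 1
    on a neighbourhood of 0, hence continuous seminorms dominating their
    families (lemma [continuous_seminorm_upper_bound]). *)

Lemma seminorm0 {R : realType} {E : lmodType R} {p : E -> R} :
  seminorm p -> p 0 = 0.
Proof. by move=> sp; rewrite -(scale0r 0) seminormZ// normr0 mul0r. Qed.

Lemma seminorm_dist_le {R : realType} {E : lmodType R} {p : E -> R} x y :
  seminorm p -> `|p x - p y| <= p (x - y).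
Proof.
move=> sp; have pN z : p (- z) = p z.
  by rewrite -scaleN1r seminormZ// normrN1 mul1r.
have le z t : p z - p t <= p (z - t).
  by rewrite lerBlDr -{1}(subrK t z) seminormD.
by rewrite ler_norml lerNl opprB le andbT -(pN (x - y)) opprB le.
Qed.

Lemma seminorm_comp {R : realType} {E F : lmodType R} (P : F -> R)
    (f : E -> F) : seminorm P -> {morph f : x y / x + y} ->
  (forall a x, f (a *: x) = a *: f x) -> seminorm (P \o f).
Proof.
move=> sP fD fZ; split=> [x|x y|a x] /=; first exact: seminorm_ge0.
  by rewrite fD seminormD.
by rewrite fZ seminormZ.
Qed.

Lemma continuous_seminormM {R : realType} {E : tvsType R} (c : R)
    (p : E -> R) : 0 <= c -> continuous_seminorm p ->
  continuous_seminorm (fun x => c * p x).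
Proof.
move=> c0 [sp cp]; split; last first.
  by move=> x; apply: cvgM; [exact: cvg_cst|exact: cp].
split=> [x|x y|a x]; first by rewrite mulr_ge0// seminorm_ge0.
  by rewrite -mulrDr ler_wpM2l// seminormD.
by rewrite seminormZ// mulrCA.
Qed.

(** The point [x + e *: u] with [u] in [U] lies at [p]-distance at most [e]
    from [x], and these points form a neighbourhood of [x]. *)
Lemma seminorm_continuous {R : realType} {E : tvsType R} (p : E -> R)
    (U : set E) : seminorm p -> nbhs 0 U -> (forall x, U x -> p x <= 1) ->
  continuous p.
Proof.
move=> sp U0 pU x; apply/cvgrPdist_le => e e0.
have /(nbhsT x) : nbhs 0 [set e *: u | u in U].
  by rewrite -(scaler0 _ e); apply: nbhsZ => //; rewrite gt_eqF.
apply: filterS => _ [_ [u Uu <-] <-].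
apply: le_trans (seminorm_dist_le _ _ sp) _.
by rewrite opprD addNKr -scaleNr seminormZ// normrN gtr0_norm// ger_pMr// pU.
Qed.

Lemma nbhs0_absorbing {R : realType} {E : tvsType R} (U : set E) (x : E) :
  nbhs 0 U -> exists2 t : R, 0 < t & U (t *: x).
Proof.
move=> U0.
have ct : t *: x @[t --> (0 : R^o)] --> (0 : R) *: x.
  apply: (@continuous2_cvg _ R^o E E _ _ id (cst x)).
  - exact: (@scale_continuous R E (0, x)).
  - exact: cvg_id.
  - exact: cvg_cst.
rewrite scale0r in ct.
have /nbhs_ballP[e /= e0 eU] := ct _ U0.
exists (e / 2); first by rewrite divr_gt0.
apply: eU; rewrite /ball/= sub0r normrN gtr0_norm ?divr_gt0//.
by rewrite ltr_pdivrMr// ltr_pMr// ltr1n.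
Qed.

(** The witness is the pointwise supremum of [G].  Since neighbourhoods of 0 are
    absorbing, a family bounded on one of them is bounded at each point, so that
    this supremum is a real number. *)
Lemma continuous_seminorm_upper_bound {R : realType} {E : tvsType R}
    (G : set (E -> R)) (U : set E) : G !=set0 -> nbhs 0 U ->
    (forall g, G g -> seminorm g) ->
    (forall g x, G g -> U x -> g x <= 1) ->
  exists2 s : E -> R, continuous_seminorm s &
    forall g x, G g -> g x <= s x.
Proof.
move=> [g0 Gg0] U0 sG GU.
pose s x := sup [set g x | g in G].
have leS g x : G g -> g x <= s x.
  move=> Gg; apply: ub_le_sup; last by exists g.
  have [t t0 Ut] := nbhs0_absorbing U x U0.
  exists t^-1 => _ [h Gh <-].
  by rewrite -[leRHS]mulr1 ler_pdivlMl// -{1}(gtr0_norm t0)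
    -(seminormZ (sG _ Gh)) GU.
have Sle x c : (forall g, G g -> g x <= c) -> s x <= c.
  move=> gc; apply: ge_sup; first by exists (g0 x), g0.
  by move=> _ [g Gg <-]; exact: gc.
have sZ_le a x : s (a *: x) <= `|a| * s x.
  by apply: Sle => g Gg; rewrite (seminormZ (sG _ Gg)) ler_wpM2l// leS.
have ss : seminorm s.
  split=> [x|x y|a x].
  - exact: le_trans (seminorm_ge0 (sG _ Gg0) x) (leS _ _ Gg0).
  - apply: Sle => g Gg; apply: le_trans (seminormD (sG _ Gg) _ _) _.
    by rewrite lerD// leS.
  - apply/eqP; rewrite eq_le sZ_le/=.
    have [->|a0] := eqVneq a 0.
      rewrite normr0 mul0r.
      exact: le_trans (seminorm_ge0 (sG _ Gg0) _) (leS _ _ Gg0).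
    rewrite -ler_pdivlMl ?normr_gt0// -normfV.
    by have := sZ_le a^-1 (a *: x); rewrite scalerA mulVf// scale1r.
exists s => //; split=> //.
apply: (seminorm_continuous _ U ss U0) => x Ux.
by apply: Sle => g Gg; exact: GU.
Qed.

(** See the introduction for the choice of [r] and [s].  When [r x > 0] the
    estimate follows from the definition of [s] by scaling [x]; when [r x = 0],
    all multiples of [x] enter the supremum [s y], which forces
    [P (beta x y) = 0]. *)
Lemma bilinear_estimate {R : realType} {E1 E2 F : tvsType R}
    (beta : {bilinear E1 -> E2 -> F}) (P : F -> R) :
    continuous (fun z : E1 * E2 => beta z.1 z.2) -> continuous_seminorm P ->
  exists (r : E1 -> R) (s : E2 -> R),
    [/\ continuous_seminorm r, continuous_seminorm s &
        forall x y, P (beta x y) <= r x * s y].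
Proof.
move=> cbeta [sP cP].
have [[U V] /= [U0 V0] UV] :
    nbhs ((0, 0) : E1 * E2) [set z | P (beta z.1 z.2) < 1].
  have : continuous (P \o (fun z : E1 * E2 => beta z.1 z.2)).
    by move=> z; apply: continuous_comp; [exact: cbeta|exact: cP].
  move=> /(_ (0, 0)) /cvgr_lt; apply.
  by rewrite /= linear0l (seminorm0 sP).
have sl y : seminorm (P \o (beta^~ y)).
  by apply: seminorm_comp => // [a b|a b]; rewrite ?linearDl ?linearZl_LR.
have sr x : seminorm (P \o beta x).
  by apply: seminorm_comp => // [a b|a b]; rewrite ?linearDr ?linearZr_LR.
have [|||r cr ler] :=
    continuous_seminorm_upper_bound [set P \o (beta^~ y) | y in V] U _ U0.
- by exists (P \o (beta^~ 0)), 0 => //; exact: nbhs_singleton.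
- by move=> _ [y _ <-].
- by move=> _ x [y Vy <-] Ux; apply/ltW/(UV (x, y)).
have leV x y : V y -> P (beta x y) <= r x.
  by move=> Vy; apply: (ler (P \o (beta^~ y))); exists y.
have [|||s cs les] :=
    continuous_seminorm_upper_bound
      [set P \o beta x | x in [set x | r x <= 1]] V _ V0.
- by exists (P \o beta 0), 0 => //=; rewrite (seminorm0 cr.1).
- by move=> _ [x _ <-].
- by move=> _ y [x /= rx <-] Vy; apply: le_trans rx; exact: leV.
exists r, s; split=> // x y.
have le1 t : r (t *: x) <= 1 -> `|t| * P (beta x y) <= s y.
  move=> rt; rewrite -(seminormZ sP) -linearZl_LR.
  by apply: (les (P \o beta (t *: x))); exists (t *: x).
have [rx0|rx_neq0] := eqVneq (r x) 0; last first.
  have rx_gt0 : 0 < r x by rewrite lt0r rx_neq0 (seminorm_ge0 cr.1).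
  rewrite -ler_pdivrMl//.
  have := le1 (r x)^-1; rewrite gtr0_norm ?invr_gt0//; apply.
  by rewrite (seminormZ cr.1) gtr0_norm ?invr_gt0// mulVf.
rewrite rx0 mul0r leNgt; apply/negP => Pxy.
have sy0 := seminorm_ge0 cs.1 y.
(* This multiple of [x] would make the value at [y] equal to [s y + 1]. *)
have := le1 ((s y + 1) / P (beta x y)).
rewrite (seminormZ cr.1) rx0 mulr0 => /(_ ler01).
rewrite ger0_norm ?divr_ge0 ?addr_ge0 ?(ltW Pxy)//.
by rewrite divfK ?gt_eqF// leNgt ltrDl ltr01.
Qed.

(** With [a n] the maximum of 1 and all [A k l] with [k, l <= n], the entry
    [A i j] is at most [a i] or [a j], according to which index is larger, and
    the other factor is at least 1. *)
Lemma double_sequence_le_product {R : realType} (A : nat -> nat -> R) :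
  exists a : nat -> R, (forall n, 0 <= a n) /\ forall i j, A i j <= a i * a j.
Proof.
pose a n := \big[Num.max/1]_(kl : 'I_n.+1 * 'I_n.+1) A kl.1 kl.2.
have a1 n : 1 <= a n by exact: bigmax_ge_id.
have Aa n i j : (i <= n)%N -> (j <= n)%N -> A i j <= a n.
  rewrite -ltnS => iltn; rewrite -ltnS => jltn.
  exact: (le_bigmax _ (fun kl : 'I_n.+1 * 'I_n.+1 => A kl.1 kl.2)
    (Ordinal iltn, Ordinal jltn)).
have a0 n : 0 <= a n by exact: le_trans ler01 (a1 n).
exists a; split=> // i j; have [ij|/ltnW ji] := leqP i j.
  by apply: le_trans (Aa j i j ij (leqnn j)) _; rewrite ler_peMl.
by apply: le_trans (Aa i i j (leqnn i) ji) _; rewrite ler_peMr.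
Qed.

Lemma cnp_double_sequence {R : realType} {E : tvsType R}
    (r : nat -> nat -> E -> R) : countable_neighbourhood_property E ->
    (forall i j, continuous_seminorm (r i j)) ->
  exists2 p : E -> R, continuous_seminorm p &
    exists2 C : nat -> nat -> R, (forall i j, 0 < C i j) &
      forall i j x, r i j x <= C i j * p x.
Proof.
move=> cnp cr.
have [||p cp rp] := cnp (range (fun ij : nat * nat => r ij.1 ij.2)).
- exact/(sub_countable (card_image_le _ _))/countableP.
- by move=> _ [ij _ <-].
exists p => //.
have /choice[C CP] ij : exists c : R,
    0 < c /\ forall x, r ij.1 ij.2 x <= c * p x.
  have [|c c0 rc] := rp (r ij.1 ij.2); first by exists ij.
  by exists c.
by exists (fun i j => C (i, j)) => i j => [|x]; have [? /(_ _)] := CP (i, j).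
Qed.

(* [tvsType] is locally convex but need not be Hausdorff. *)
Theorem proposition4p1 (R : realType) (E1 E2 F : tvsType R)
    (E1_hausdorff : hausdorff_space E1) (E2_hausdorff : hausdorff_space E2)
    (F_hausdorff : hausdorff_space F)
    (beta : {bilinear E1 -> E2 -> F})
    (beta_continuous : continuous (fun z : E1 * E2 => beta z.1 z.2))
    (E1_cnp : countable_neighbourhood_property E1)
    (E2_cnp : countable_neighbourhood_property E2) :
  product_estimates beta.
Proof.
move=> pij cpij.
have /choice[rs rsP] ij : exists rs : (E1 -> R) * (E2 -> R),
    [/\ continuous_seminorm rs.1, continuous_seminorm rs.2 &
        forall x y, pij ij.1 ij.2 (beta x y) <= rs.1 x * rs.2 y].
  have [r [s rsP]] := bilinear_estimate beta _ beta_continuous (cpij ij.1 ij.2).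
  by exists (r, s).
have [|p cp [C C0 rC]] := cnp_double_sequence (fun i j => (rs (i, j)).1) E1_cnp.
  by move=> i j; have [] := rsP (i, j).
have [|q cq [D D0 sD]] := cnp_double_sequence (fun i j => (rs (i, j)).2) E2_cnp.
  by move=> i j; have [] := rsP (i, j).
have [a [a0 CDa]] := double_sequence_le_product (fun i j => C i j * D i j).
exists (fun i x => a i * p x), (fun j y => a j * q y); split.
- by move=> i; exact: continuous_seminormM.
- by move=> j; exact: continuous_seminormM.
move=> i j x y; have [cr cs rs_le] := rsP (i, j).
apply: le_trans (rs_le x y) _.
apply: (@le_trans _ _ ((C i j * p x) * (D i j * q y))).
  by rewrite ler_pM ?(seminorm_ge0 cr.1) ?(seminorm_ge0 cs.1).
rewrite mulrACA (mulrACA (a i)) ler_wpM2r//.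
by rewrite mulr_ge0 ?(seminorm_ge0 cp.1) ?(seminorm_ge0 cq.1).
Qed.
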